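(* Let $L>0$, $\sigma\ge0$, $m\ge0$ and let $f\in\mathcal S_{0,L}$, with global minimizer $x^\star$. Put $L_\sigma=(1+\sigma^2)L$ and, for $k\ge0$, $$\alpha_k=\frac2{k+1},\qquad \tilde\alpha_k=\frac{\alpha_k}{1+m\alpha_k},\qquad \frac{\gamma_k}{1+\sigma^2}=\alpha_k\tilde\alpha_kL_\sigma,\qquad \beta_k=\frac{\alpha_k}{\gamma_k/(1+\sigma^2)},\qquad \tilde\gamma_k=\frac{\gamma_k}{1+m\alpha_k}=\tilde\alpha_k^2(1+\sigma^2)^2L.$$ Starting from $x_0=v_0\in\mathbb R^d$, let $(x_k,v_k)_{k\ge0}$ be generated by the SHANG++ recursion (with $\mu=0$) $$\frac{x_{k+1}-x_k}{\tilde\alpha_k}=v_k-x_{k+1}-\beta_kg(x_k),\qquad \frac{v_{k+1}-v_k}{\alpha_k}=-\frac1{\gamma_k}g(x_{k+1}),$$ where the stochastic gradients are conditionally unbiased and satisfy the multiplicative noise scaling (MNS) condition with constant $\sigma$. Let $x_k^+=x_k-\tilde\alpha_k\beta_kg(x_k)$. Then for all $k\ge0$, $$\mathbb E\Big[f(x_{k+1}^+)-f(x^\star)+\frac{\tilde\gamma_{k+1}}2\|v_{k+1}-x^\star\|^2\Big]\le\frac{(1+2m)(2+2m)}{(k+2+2m)(k+3+2m)}\,\mathcal E_0,$$ where $\mathcal E_0=\mathbb E\big[f(x_0^+)-f(x^\star)+\frac{\tilde\gamma_0}2\|v_0-x^\star\|^2\big]$.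
   Context: $\|\cdot\|$ is the Euclidean norm on $\mathbb R^d$. $\mathcal S_{0,L}$ is the class of differentiable convex functions $f:\mathbb R^d\to\mathbb R$ that are $L$-smooth, i.e. $\|\nabla f(y)-\nabla f(x)\|\le L\|y-x\|$ for all $x,y$. It is assumed that $f$ has a global minimizer, denoted $x^\star$. Stochastic gradients: all random objects live on a complete probability space. For each $k\ge0$, $g(x_k)$ is a random vector in $\mathbb R^d$ (one sample per index $k$; the same sample $g(x_k)$ is used wherever it appears). $\mathcal F_k$ is the $\sigma$-algebra of information available before sampling $g(x_k)$, i.e. generated by the initial data and $g(x_0),\dots,g(x_{k-1})$; thus $x_k$ is $\mathcal F_k$-measurable. In the recursion, $x_k^+$, $x_{k+1}$ and $v_k$ are determined before $g(x_{k+1})$ is sampled and are $\mathcal F_{k+1}$-measurable. Conditional unbiasedness means $\mathbb E[g(x_k)\mid\mathcal F_k]=\nabla f(x_k)$ for all $k\ge0$. The MNS condition with constant $\sigma\ge0$ means $\mathbb E[\|g(x_k)-\nabla f(x_k)\|^2\mid\mathcal F_k]\le\sigma^2\|\nabla f(x_k)\|^2$ for all $k\ge0$. *)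

(* Defs.v *)
From mathcomp Require Import all_boot all_order all_algebra.
From mathcomp Require Import all_classical all_reals all_analysis.
From mathcomp Require Import measurable_realfun.

Set Implicit Arguments.
Unset Strict Implicit.
Unset Printing Implicit Defensive.

Import Order.TTheory GRing.Theory Num.Theory.
Import numFieldNormedType.Exports.

Local Open Scope classical_set_scope.
Local Open Scope ring_scope.

Section Euclidean.
Context {R : realType} {d : nat}.
Implicit Types (f : 'rV[R]_d -> R) (x : 'rV[R]_d).

(* The norm `|x| that the library puts on matrices is the sup norm. *)
Definition enorm x : R := Num.sqrt (\sum_(i < d) x ord0 i ^+ 2).

Definition gradient f x : 'rV[R]_d := \row_i 'D_(delta_mx ord0 i) f x.

Definition smooth_convex (L : R) f : Prop :=
  [/\ forall x, differentiable f x,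
      convex_function (setT : set (convex_lmodType 'rV[R]_d)) f &
      forall x y, enorm (gradient f y - gradient f x) <= L * enorm (y - x)].

End Euclidean.

Section Stochastic.
Context {disp : measure_display} {T : measurableType disp} {R : realType}
  {d : nat}.
Implicit Types (P : probability T R) (F : set_system T)
  (X : T -> 'rV[R]_d) (g x v : nat -> T -> 'rV[R]_d).

Definition random_vector X : Prop :=
  forall i, measurable_fun setT (fun w => X w ord0 i).

(* Preimages of Borel sets by the coordinates of X: a generating family of
   sigma(X). *)
Definition coordinate_preimages X : set_system T :=
  \bigcup_(i : 'I_d) preimage_set_system setT (fun w => X w ord0 i) measurable.

(* F_k = sigma(x_0, g_0, ..., g_{k-1}), where x_0 is the initial datum. *)
Definition history (x0 : T -> 'rV[R]_d) g (k : nat) : set_system T :=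
  <<s coordinate_preimages x0 `|`
      \bigcup_(j in [set j | (j < k)%N]) coordinate_preimages (g j) >>.

(* Y is a version of E[X | F], for X integrable or nonnegative (the two cases
   in which the conditional expectation is defined). *)
Definition cond_expectation P F (X Y : T -> \bar R) : Prop :=
  [/\ P.-integrable setT X \/
        (measurable_fun setT X /\ forall w, (0 <= X w)%E),
      forall B : set (\bar R), measurable B -> F (Y @^-1` B) &
      forall A, F A -> (\int[P]_(w in A) X w = \int[P]_(w in A) Y w)%E].

(* E[g_k | F_k] = grad f (x_k), coordinatewise. *)
Definition cond_unbiased P (f : 'rV[R]_d -> R) x g : Prop :=
  forall k i, cond_expectation P (history (x 0%N) g k)
    (fun w => (g k w ord0 i)%:E)
    (fun w => (gradient f (x k w) ord0 i)%:E).

(* E[|g_k - grad f (x_k)|^2 | F_k] <= sigma^2 |grad f (x_k)|^2 a.s. *)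
Definition mult_noise_scaling P (sigma : R) (f : 'rV[R]_d -> R) x g : Prop :=
  forall k, exists2 Y : T -> \bar R,
    cond_expectation P (history (x 0%N) g k)
      (fun w => (enorm (g k w - gradient f (x k w)) ^+ 2)%:E) Y &
    {ae P, forall w, (Y w <= (sigma ^+ 2 * enorm (gradient f (x k w)) ^+ 2)%:E)%E}.

End Stochastic.

Section SHANGpp.
Context {R : realType}.
Variables (L sigma m : R).

Definition Lsigma : R := (1 + sigma ^+ 2) * L.

Definition alpha (k : nat) : R := 2 / (k%:R + 1).

Definition talpha (k : nat) : R := alpha k / (1 + m * alpha k).

Definition gamma (k : nat) : R :=
  (1 + sigma ^+ 2) * (alpha k * talpha k * Lsigma).

Definition beta (k : nat) : R := alpha k / (gamma k / (1 + sigma ^+ 2)).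

Definition tgamma (k : nat) : R := gamma k / (1 + m * alpha k).

Context {T : Type} {d : nat}.
Variables (g x v : nat -> T -> 'rV[R]_d).

(* g k is the sample g(x_k). *)
Definition shangpp : Prop := forall k w,
  (talpha k)^-1 *: (x k.+1 w - x k w)
    = v k w - x k.+1 w - beta k *: g k w /\
  (alpha k)^-1 *: (v k.+1 w - v k w) = - ((gamma k)^-1 *: g k.+1 w).

Definition xplus (k : nat) (w : T) : 'rV[R]_d :=
  x k w - (talpha k * beta k) *: g k w.

End SHANGpp.

(* Main.v *)
Require Import Defs.
From mathcomp Require Import all_boot all_order all_algebra.
From mathcomp Require Import all_classical all_reals all_analysis.
From mathcomp Require Import measurable_realfun.
From mathcomp Require Import ring lra.

Import Order.TTheory GRing.Theory Num.Theory.
Import numFieldNormedType.Exports.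

Local Open Scope classical_set_scope.
Local Open Scope ring_scope.

(** Write t_k for the damped step size talpha_k and s for 1 + sigma^2.  The
    recursion is a Nesterov scheme in disguise: x_k^+ is a gradient step of
    length 1/(sL) from x_k, the point x_{k+1} is the convex combination
    (x_k^+ + t_k v_k)/(1 + t_k), and v_{k+1} is v_k minus
    g(x_{k+1})/(s^2 L t_k).

    The heart of the matter is a pointwise inequality ([one_step],
    [energy_step_pointwise]).  With G = grad f(x_{k+1}), noise
    n = g(x_{k+1}) - G and energy e_k,

      (1 + t_k) e_{k+1} <= e_k + <u, n> + b (|n|^2 - sigma^2 |G|^2),

    where b >= 0 is a constant and u is an affine function of G and v_k.  It
    adds up the descent lemma at x_{k+1}^+, which gains a multiple of |G|^2,
    and the gradient inequalities of the convex function f at x_k^+ and at the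
    minimizer; the weights 1, t_k, 1 + t_k are such that all terms in f(x_{k+1})
    and all inner products with v_k cancel.  The factors 1/(sL) and
    1/(s^2 L t_k) are exactly those for which the second moment s |G|^2 of the
    stochastic gradient is absorbed by the gain of the descent lemma.

    In expectation both error terms disappear.  The vector u is known before
    g(x_{k+1}) is sampled, so <u, n> has mean zero by unbiasedness
    ([expectation_edot_residual]), and the last term has nonpositive mean by
    the noise scaling condition ([expectation_noise_le]).  Hence
    (1 + t_k) E e_{k+1} <= E e_k, and since t_k = 2/(k + 1 + 2m) the product of
    the factors 1/(1 + t_j) telescopes to the announced rate ([rateS]).

    These expectations need integrability.  If E e_0 is infinite, the bound is
    trivial.  If it is finite, then x_0 is square integrable, because e_0
    dominates a positive multiple of |x_0 - xstar|^2; Lipschitz continuity of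
    the gradient, noise scaling and the recursion then propagate square
    integrability to every iterate ([square_integrable_iterates]). *)

(** * Smooth convex functions on Euclidean space *)

Section EuclideanGeometry.
Context {R : realType} {d : nat}.
Implicit Types (f : 'rV[R]_d -> R) (x y z : 'rV[R]_d).

Definition edot x y : R := \sum_(i < d) x ord0 i * y ord0 i.

Lemma edotC x y : edot x y = edot y x.
Proof. by apply: eq_bigr => i _; rewrite mulrC. Qed.

Lemma edotDl x y z : edot (x + y) z = edot x z + edot y z.
Proof. by rewrite -big_split; apply: eq_bigr => i _; rewrite mxE mulrDl. Qed.

Lemma edotZl (a : R) x z : edot (a *: x) z = a * edot x z.
Proof. by rewrite mulr_sumr; apply: eq_bigr => i _; rewrite mxE mulrA. Qed.

Lemma edotNl x z : edot (- x) z = - edot x z.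
Proof. by rewrite -scaleN1r edotZl mulN1r. Qed.

Lemma edotDr x y z : edot z (x + y) = edot z x + edot z y.
Proof. by rewrite !(edotC z) edotDl. Qed.

Lemma edotZr (a : R) x z : edot z (a *: x) = a * edot z x.
Proof. by rewrite !(edotC z) edotZl. Qed.

Lemma edotNr x z : edot z (- x) = - edot z x.
Proof. by rewrite !(edotC z) edotNl. Qed.

Definition edotE := (edotDl, edotDr, edotNl, edotNr, edotZl, edotZr).

Lemma edot_ge0 x : 0 <= edot x x.
Proof. by apply: sumr_ge0 => i _; rewrite -expr2 sqr_ge0. Qed.

Lemma enorm_sqr x : enorm x ^+ 2 = edot x x.
Proof.
have <- : \sum_(i < d) x ord0 i ^+ 2 = edot x x.
  by apply: eq_bigr => i _; rewrite expr2.
by rewrite sqr_sqrtr// sumr_ge0// => i _; rewrite sqr_ge0.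
Qed.

Lemma enorm_ge0 x : 0 <= enorm x.
Proof. exact: sqrtr_ge0. Qed.

Lemma enormZ (a : R) x : 0 <= a -> enorm (a *: x) = a * enorm x.
Proof.
move=> a0; apply/eqP; rewrite -(@eqrXn2 _ 2) ?mulr_ge0 ?enorm_ge0//.
by rewrite exprMn !enorm_sqr !edotE; apply/eqP; ring.
Qed.

Lemma coord_sqr_le x i : x ord0 i ^+ 2 <= enorm x ^+ 2.
Proof.
rewrite enorm_sqr /edot (bigD1 i)//= -expr2 lerDl.
by apply: sumr_ge0 => j _; rewrite -expr2 sqr_ge0.
Qed.

(** The Cauchy-Schwarz inequality, read off from the nonnegativity of the square
    norm of <x, x> y - <x, y> x. *)
Lemma edot_le_enorm x y : edot x y <= enorm x * enorm y.
Proof.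
have [x0|x0] := eqVneq (edot x x) 0.
  have xi i : x ord0 i = 0.
    apply/eqP; rewrite -sqrf_eq0 eq_le sqr_ge0 andbT.
    by rewrite -x0 -enorm_sqr coord_sqr_le.
  rewrite /edot big1; last by move=> i _; rewrite xi mul0r.
  by rewrite mulr_ge0 ?enorm_ge0.
have xp : 0 < edot x x by rewrite lt_neqAle eq_sym x0 edot_ge0.
apply: le_trans (ler_norm _) _.
rewrite -(@ler_pXn2r _ 2)// ?nnegrE ?mulr_ge0 ?enorm_ge0//.
rewrite real_normK ?num_real// exprMn !enorm_sqr.
have := edot_ge0 (edot x x *: y - edot x y *: x).
rewrite !edotE (edotC y x) => h.
rewrite -subr_ge0 -(pmulr_rge0 _ xp).
by move: h; congr (0 <= _); ring.
Qed.

Lemma derive_gradient f x h : differentiable f x ->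
  'D_h f x = edot (gradient f x) h.
Proof.
move=> df; rewrite deriveE// {1}(row_sum_delta h) linear_sum.
apply: eq_bigr => i _; rewrite linearZ/= mxE deriveE//.
by rewrite mulrC.
Qed.

(** The difference quotients of f along the line are those of f in the direction
    h, so both derivatives are limits of the same function. *)
Lemma is_derive_line f x h (t : R) : differentiable f (x + t *: h) ->
  is_derive t 1 (fun s : R => f (x + s *: h))
    (edot (gradient f (x + t *: h)) h).
Proof.
move=> df.
have E : (fun s : R => s^-1 *: (f (x + (s *: 1 + t) *: h) - f (x + t *: h))) =
         (fun s : R => s^-1 *: (f (s *: h + (x + t *: h)) - f (x + t *: h))).
  apply/funext => s; congr (_ *: (f _ - _)).
  by rewrite scalerDl addrCA scaler1.
split.
  have := diff_derivable df (v := h); rewrite /derivable.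
  by rewrite -E.
by rewrite -derive_gradient// /derive E.
Qed.

(** By convexity every difference quotient of f at x towards y, with step in
    ]0, 1], is at most f y - f x; the directional derivative is their limit from
    the right. *)
Lemma gradient_lower_bound f x y : differentiable f x ->
  convex_function (setT : set (convex_lmodType 'rV[R]_d)) f ->
  f x + edot (gradient f x) (y - x) <= f y.
Proof.
move=> df cf; rewrite addrC -lerBrDr -derive_gradient//.
have cvgD : h^-1 *: (f (h *: (y - x) + x) - f x) @[h --> 0^'+]
    --> 'D_(y - x) f x.
  apply: cvg_trans (diff_derivable df (v := y - x)).
  apply: cvg_app; apply: within_subset => h /=; exact: lt0r_neq0.
apply: (cvgr_to_le cvgD); near=> h.
have h0 : 0 < h by near: h; exact: nbhs_right_gt.
have h1 : h <= 1 by near: h; exact: nbhs_right_le.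
have /= := cf (Itv01 (ltW h0) h1) y x (mem_setT _) (mem_setT _).
(* the convex combination is taken in a copy of the space of row vectors *)
rewrite [X in f X <= _](_ : _ = h *: (y - x) + x); last first.
  rewrite -[LHS]/(h *: y + (1 - h) *: x).
  by rewrite scalerBl scale1r scalerBr addrA addrAC.
rewrite convRE /= /unstable.onem => le_f.
rewrite -[_ *: _]/(_ * _) mulrC ler_pdivrMr// lerBlDr.
by apply: le_trans le_f _; rewrite le_eqVlt; apply/orP; left; apply/eqP; ring.
Unshelve. all: by end_near. Qed.

(** Along the segment from x to y, the difference of f and the quadratic upper
    model has derivative at most zero, by Cauchy-Schwarz and the Lipschitz
    bound; hence it does not increase between the end points. *)
Lemma descent_lemma (L : R) f x y :
  (forall z, differentiable f z) ->
  (forall z w, enorm (gradient f w - gradient f z) <= L * enorm (w - z)) ->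
  f y <= f x + edot (gradient f x) (y - x) + L / 2 * edot (y - x) (y - x).
Proof.
move=> df lip; set h := y - x; set D := edot h h.
pose p (t : R) :=
  f (x + t *: h) - t * edot (gradient f x) h - t ^+ 2 * (L / 2 * D).
have dp (t : R) : is_derive t (1 : R) p
   (edot (gradient f (x + t *: h)) h - edot (gradient f x) h - t * L * D).
  pose proof (is_derive_line f x h t (df _)).
  apply: is_derive_eq; rewrite /GRing.scale/=.
  by set u := edot (gradient f (x + t *: h)) h; field.
have p10 : p 1 <= p 0.
  apply: (@ler0_derive1_le_cc _ p 0 1); rewrite ?in_itv/= ?lexx ?ler01//.
  - move=> t; rewrite in_itv/= => /andP[t0 _].
    rewrite derive1E derive_val subr_le0 -edotNl -edotDl.
    apply: le_trans (edot_le_enorm _ _) _.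
    apply: le_trans (ler_wpM2r (enorm_ge0 _) (lip _ _)) _.
    rewrite [x + _]addrC addrK enormZ; last exact: ltW.
    by rewrite /D -enorm_sqr le_eqVlt; apply/orP; left; apply/eqP; ring.
  - apply: continuous_subspaceT => t.
    by apply/differentiable_continuous/derivable1_diffP; exact: ex_derive.
move: p10; rewrite /p scale0r addr0 scale1r {1}/h [x + _]addrC subrK.
lra.
Qed.

End EuclideanGeometry.

(** * Continuous functions of random vectors *)

Section Measurability.
Context {disp : measure_display} {T : measurableType disp} {R : realType}
  {d : nat}.

(** Measurability of a random vector is only known coordinate by coordinate.  An
    open set is the union of the rational boxes that it contains, and these are
    countably many. *)
Lemma measurable_continuous_comp (f : 'rV[R]_d -> R) (X : T -> 'rV[R]_d) :
  continuous f -> random_vector X -> measurable_fun setT (f \o X).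
Proof.
move=> /continuousP cf mX; apply: (measurability _ (RGenOpens.measurableE R)).
move=> _ [_ [a [b ->] <-]].
rewrite setTI comp_preimage.
have := cf _ (@interval_open _ (BRight a) (BLeft b) isT isT).
set U := f @^-1` _ => oU.
(* [box (q, n)] is where X lies within 1/(n+1) of q; [boxn] runs through all
   boxes. *)
pose box (q : 'rV[rat]_d * nat) : set T := \bigcap_(i : 'I_d)
  [set w | `|X w ord0 i - ratr (q.1 ord0 i)| < q.2.+1%:R^-1].
pose boxn n := if unpickle n is Some q then box q else set0.
have -> : X @^-1` U = \bigcup_(n in [set n | boxn n `<=` X @^-1` U]) boxn n.
  apply/seteqP; split => [w /= Uw|w [n /= +]]; last exact.
  have [/= e e0 Be] := (nbhs_ballP _ _).1 (open_nbhs_nbhs (conj oU Uw)).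
  have [n _ /(_ n (leqnn n)) /= ne] :=
    near_infty_natSinv_lt (PosNum (divr_gt0 e0 (ltr0Sn R 1))).
  have qX i : exists q : rat, `|X w ord0 i - ratr q| < n.+1%:R^-1.
    have /rat_in_itvoo[q] : X w ord0 i < X w ord0 i + n.+1%:R^-1.
      by rewrite ltrDl invr_gt0.
    rewrite in_itv/= => /andP[q1 q2]; exists q.
    by rewrite distrC gtr0_norm ?subr_gt0// ltrBlDl.
  have [q qE] := choice qX.
  exists (pickle (\row_i q i, n)); rewrite /= /boxn pickleK; last first.
    by move=> i _ /=; rewrite mxE.
  move=> w' /= bw'; apply: Be; split=> // i j; rewrite /ball/= ord1.
  have := bw' j I; rewrite /= mxE => hj.
  rewrite -(subrK (ratr (q j)) (X w _ _)) -addrA.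
  rewrite (le_lt_trans (ler_normD _ _))// [ltRHS]splitr.
  by rewrite ltrD// ?(lt_trans (qE j))// distrC (lt_trans hj).
apply: bigcup_measurable => n _; rewrite /boxn; case: unpickle => [q|//].
apply: fin_bigcap_measurable => [|i _]; first exact: finite_finset.
have mi : measurable_fun setT (fun w => `|X w ord0 i - ratr (q.1 ord0 i)|).
  apply: measurableT_comp => //.
  by apply: measurable_funB => //; exact: mX.
have := mi measurableT _ (measurable_itv `]-oo, q.2.+1%:R^-1[).
by rewrite setTI; congr measurable; apply/seteqP; split => w/=; rewrite in_itv.
Qed.

End Measurability.

(** * Orthogonality to a sub-sigma-algebra *)

Section Orthogonality.
Context {disp : measure_display} {T : measurableType disp} {R : realType}.
Variable P : probability T R.

Lemma generated_measurable (G : set_system T) (A : set T) :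
  G `<=` measurable -> <<s G >> A -> measurable A.
Proof.
by move=> GT; apply: smallest_sub => //; exact: sigma_algebra_measurable.
Qed.

Definition sub_measurable (G : set_system T) (Z : T -> R) : Prop :=
  measurable_fun (setT : set (g_sigma_algebraType G)) Z.

Lemma sub_measurableW (G : set_system T) (Z : T -> R) :
  G `<=` measurable -> sub_measurable G Z -> measurable_fun setT Z.
Proof.
move=> GT mZ _ B mB.
exact: (generated_measurable _ _ GT (mZ measurableT B mB)).
Qed.

Section OrthogonalToSubSigmaAlgebra.
Variables (G : set_system T) (W : T -> R).
Hypotheses (GT : G `<=` measurable) (iW : P.-integrable setT (EFin \o W)).
Hypothesis W0 : forall A, <<s G >> A -> (\int[P]_(w in A) (W w)%:E = 0)%E.

Import HBSimple HBNNSimple.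

(** On the values of a simple function h the integral splits into integrals of W
    over members of the sub-sigma-algebra. *)
Lemma integral_mul_simple (h : {nnsfun (g_sigma_algebraType G) >-> R}) :
  (\int[P]_w (h w * W w)%:E = 0)%E.
Proof.
have mA y : disp.-measurable (h @^-1` [set y] : set T).
  exact: (generated_measurable _ _ GT (measurable_sfunP h (measurable_set1 y))).
have -> : (fun w => (h w * W w)%:E) = (fun w =>
    \sum_(y <- finmap.enum_fset (fset_set (range h)))
      (y%:E * ((EFin \o W) \_ (h @^-1` [set y])) w))%E.
  apply/funext => w; rewrite fimfunE fsbig_finite//= mulr_suml -sumEFin.
  apply: eq_bigr => y _; rewrite -mulrA EFinM; congr (_ * _)%E.
  by rewrite patchE indicE; case: ifP => _; rewrite ?mul1r ?mul0r.
have iWA y : P.-integrable setT ((EFin \o W) \_ (h @^-1` [set y])).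
  apply/(integrable_mkcond (EFin \o W) (mA y)).
  exact: (integrableS measurableT (mA y) (@subsetT _ _) iW).
rewrite integral_sum//; last by move=> y; exact: integrableZl.
rewrite big1// => y _; rewrite integralZl// -integral_mkcond W0 ?mule0//.
exact: (measurable_sfunP h (measurable_set1 y)).
Qed.

(** Simple functions that increase to Z are dominated by Z, so dominated
    convergence with bound |Z W| applies even when Z is unbounded. *)
Lemma integral_mul_ge0 (Z : T -> R) : (forall w, 0 <= Z w) ->
  sub_measurable G Z -> P.-integrable setT (fun w => (Z w * W w)%:E) ->
  (\int[P]_w (Z w * W w)%:E = 0)%E.
Proof.
move=> Z0 mZ iZW.
have mZ' : measurable_fun (setT : set (g_sigma_algebraType G)) (EFin \o Z).
  exact/measurable_EFinP.
pose h := nnsfun_approx measurableT mZ'.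
have hZ w : h ^~ w @ \oo --> Z w.
  have /= := cvg_nnsfun_approx measurableT mZ' (fun w _ => Z0 w) (x := w) I.
  by move/fine_cvgP => -[].
have hle n w : h n w <= Z w.
  have ndh : nondecreasing_seq (h ^~ w).
    move=> a b ab.
    by have := nd_nnsfun_approx measurableT mZ' ab => /lefP; exact.
  rewrite -(cvg_lim _ (hZ w))//; apply: nondecreasing_cvgn_le => //.
  by apply/cvg_ex; exists (Z w).
have := @dominated_convergence _ _ _ P setT measurableT
  (fun n w => (h n w * W w)%:E) (fun w => (Z w * W w)%:E)
  (fun w => `| (Z w * W w)%:E|%E).
have mW : measurable_fun setT W by exact/measurable_EFinP/(measurable_int _ iW).
case.
- move=> n; apply/measurable_EFinP/measurable_funM => //.
  exact/(sub_measurableW G)/measurable_funP.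
- exact: measurable_int iZW.
- apply/aeW => w _; apply: cvg_EFin; first by near=> n.
  exact: cvgMl.
- exact: integrable_abse.
- apply/aeW => w n _; rewrite lee_fin !normrM ler_wpM2r//.
  by rewrite !ger0_norm.
move=> _ _ /cvg_lim <-//.
by under eq_fun do rewrite integral_mul_simple; exact: lim_cst.
Unshelve. all: by end_near. Qed.

(** The general case follows by splitting Z into positive and negative parts,
    whose products with W inherit integrability from Z W. *)
Lemma integral_mul_sub_measurable (Z : T -> R) :
  sub_measurable G Z -> P.-integrable setT (fun w => (Z w * W w)%:E) ->
  (\int[P]_w (Z w * W w)%:E = 0)%E.
Proof.
move=> mZ iZW.
pose Zp w := Num.max (Z w) 0; pose Zn w := Num.max (- Z w) 0.
have mZp : sub_measurable G Zp by exact: measurable_maxr.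
have mZn : sub_measurable G Zn.
  by apply: measurable_maxr => //; exact: measurableT_comp.
have mW : measurable_fun setT W by exact/measurable_EFinP/(measurable_int _ iW).
have part (V : T -> R) : sub_measurable G V -> (forall w, `|V w| <= `|Z w|) ->
    P.-integrable setT (fun w => (V w * W w)%:E).
  move=> mV VZ; apply: le_integrable iZW => //.
    by apply/measurable_EFinP/measurable_funM => //; exact: sub_measurableW mV.
  by move=> w _; rewrite lee_fin !normrM ler_wpM2r.
have iZp : P.-integrable setT (fun w => (Zp w * W w)%:E).
  apply: part => // w; rewrite /Zp; have [Z0|Z0] := leP (Z w) 0 => //.
  by rewrite normr0.
have iZn : P.-integrable setT (fun w => (Zn w * W w)%:E).
  apply: part => // w; rewrite /Zn; have [Z0|Z0] := leP (- Z w) 0.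
    by rewrite normr0.
  by rewrite normrN.
have E w : ((Z w * W w)%:E = (Zp w * W w)%:E - (Zn w * W w)%:E)%E.
  rewrite -EFinB -mulrBl; congr (_ * _)%:E; rewrite /Zp /Zn.
  by have [] := leP (Z w) 0; have [] := leP (- Z w) 0; lra.
under eq_integral do rewrite E.
rewrite integralB//.
by rewrite !integral_mul_ge0 ?sube0// => w; rewrite le_max lexx orbT.
Qed.

End OrthogonalToSubSigmaAlgebra.
End Orthogonality.

(** * Step sizes and the deterministic energy inequality *)

Section StepSizes.
Context {R : realType} {L sigma m : R}.
Hypotheses (L0 : 0 < L) (m0 : 0 <= m).
Implicit Type k : nat.

Lemma shifted_index_gt0 k (c : R) : 0 < c -> 0 < k%:R + c + 2 * m.
Proof. by move=> c0; rewrite ltr_wpDr ?mulr_ge0// ltr_wpDl. Qed.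

Lemma alpha_gt0 k : 0 < alpha k :> R.
Proof. by rewrite divr_gt0// ltr_wpDl. Qed.

(** The damping by m amounts to a shift of the index by 2m. *)
Lemma talphaE k : talpha m k = 2 / (k%:R + 1 + 2 * m).
Proof.
rewrite /talpha /alpha; field.
by rewrite !gt_eqF ?shifted_index_gt0// ltr_wpDl.
Qed.

Lemma talpha_gt0 k : 0 < talpha m k.
Proof. by rewrite talphaE divr_gt0// shifted_index_gt0. Qed.

Lemma noise_factor_gt0 : 0 < 1 + sigma ^+ 2.
Proof. by rewrite ltr_pwDl// sqr_ge0. Qed.

Lemma alphaD_gt0 k : 0 < 1 + m * alpha k.
Proof. by rewrite ltr_pwDl// mulr_ge0// ltW// alpha_gt0. Qed.

(** The step from x_k to x_k^+ has the constant length 1/(sL). *)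
Lemma talpha_beta k :
  talpha m k * beta L sigma m k = ((1 + sigma ^+ 2) * L)^-1.
Proof.
have ? := lt0r_neq0 L0; have ? := lt0r_neq0 noise_factor_gt0.
have ? := lt0r_neq0 (alpha_gt0 k); have ? := lt0r_neq0 (talpha_gt0 k).
by rewrite /beta /gamma /Lsigma; field; apply/and4P.
Qed.

Lemma alpha_div_gamma k :
  alpha k / gamma L sigma m k = ((1 + sigma ^+ 2) ^+ 2 * L * talpha m k)^-1.
Proof.
have ? := lt0r_neq0 L0; have ? := lt0r_neq0 noise_factor_gt0.
have ? := lt0r_neq0 (alpha_gt0 k); have ? := lt0r_neq0 (talpha_gt0 k).
by rewrite /gamma /Lsigma; field; apply/and4P.
Qed.

Lemma tgammaE k :
  tgamma L sigma m k = (1 + sigma ^+ 2) ^+ 2 * L * talpha m k ^+ 2.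
Proof.
have ? := lt0r_neq0 (alphaD_gt0 k).
by rewrite /tgamma /gamma /Lsigma /talpha; field.
Qed.

Lemma tgamma_gt0 k : 0 < tgamma L sigma m k.
Proof.
rewrite tgammaE; apply: mulr_gt0; last exact/exprn_gt0/talpha_gt0.
by apply: mulr_gt0 => //; exact/exprn_gt0/noise_factor_gt0.
Qed.

(** With n = k + 1 + 2m this is n (n + 2) <= (n + 1)^2: the weight of the
    distance term decreases at least as fast as the contraction factor asks. *)
Lemma tgamma_decay k :
  (1 + talpha m k) * tgamma L sigma m k.+1 <= tgamma L sigma m k.
Proof.
rewrite !tgammaE mulrCA ler_pM2l; last first.
  by apply: mulr_gt0 => //; exact/exprn_gt0/noise_factor_gt0.
rewrite !talphaE -(natr1 k); set n := k%:R + 1 + 2 * m.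
have n0 : 0 < n by exact: shifted_index_gt0.
have -> : k%:R + 1 + 1 + 2 * m = n + 1 by rewrite /n; ring.
have n1 : 0 < n + 1 by lra.
rewrite -subr_ge0.
have -> : (2 / n) ^+ 2 - (1 + 2 / n) * (2 / (n + 1)) ^+ 2 =
    4 / (n ^+ 2 * (n + 1) ^+ 2).
  by field; rewrite !gt_eqF.
by rewrite divr_ge0// ltW// mulr_gt0// exprn_gt0.
Qed.

(** The product of the factors 1/(1 + t_j) = (j + 1 + 2m)/(j + 3 + 2m) over
    j < k, after telescoping. *)
Definition rate k : R := (1 + 2 * m) * (2 + 2 * m) /
  ((k%:R + 1 + 2 * m) * (k%:R + 2 + 2 * m)).

Lemma rate0 : rate 0 = 1.
Proof.
rewrite /rate !add0r divff// mulf_neq0// gt_eqF// ltr_wpDr// mulr_ge0//.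
Qed.

Lemma rateS k : rate k = (1 + talpha m k) * rate k.+1.
Proof.
have k1 := shifted_index_gt0 k 1 ltr01.
have k2 : 0 < k%:R + 2 + 2 * m by exact: shifted_index_gt0.
have k3 : 0 < k%:R + 3 + 2 * m by exact: shifted_index_gt0.
rewrite talphaE /rate -(natr1 k).
have -> : k%:R + 1 + 1 + 2 * m = k%:R + 2 + 2 * m by ring.
have -> : k%:R + 1 + 2 + 2 * m = k%:R + 3 + 2 * m by ring.
by field; rewrite !gt_eqF.
Qed.

End StepSizes.

Section OneStep.
Context {R : realType} {d : nat}.
Variables (L sigma : R) (f : 'rV[R]_d -> R) (xstar : 'rV[R]_d).
Hypotheses (L0 : 0 < L) (fS : smooth_convex L f).

Let s := 1 + sigma ^+ 2.

(** The square norm of g enters the energy with (1 + t)/(2 s^2 L) from the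
    descent lemma and with 1/(2 s^2 L) from the update of v; this is the sum. *)
Definition noise_weight (t : R) : R := (2 + t) / (2 * (s ^+ 2 * L)).

(** The coefficient of the noise in the part of the energy that is linear in it:
    2 [noise_weight] comes from expanding the square norm of g, the second
    multiple of the gradient from the linear term of the descent lemma, and the
    last term from the square norm of v^+ - xstar. *)
Definition noise_direction (t : R) (x v : 'rV[R]_d) : 'rV[R]_d :=
  (2 * noise_weight t - (1 + t) / (s * L)) *: gradient f x - t *: (v - xstar).

(** The difference of the two sides is a sum of four nonnegative terms: the
    gradient inequality at p, t times the one at the minimizer, 1 + t times the
    descent lemma, and the surplus t/(2sL) |G|^2.  The hypothesis on x - p turns
    the inner product of G with p - x into one with v - x, which is what makes
    the terms with v cancel. *)
Lemma one_step (t : R) (p x v g : 'rV[R]_d) : 0 < t ->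
  x - p = t *: (v - x) ->
  let G := gradient f x in
  (1 + t) * (f (x - (s * L)^-1 *: g) - f xstar)
    + s ^+ 2 * L * t ^+ 2 / 2
        * edot (v - (s ^+ 2 * L * t)^-1 *: g - xstar)
               (v - (s ^+ 2 * L * t)^-1 *: g - xstar)
  <= f p - f xstar + s ^+ 2 * L * t ^+ 2 / 2 * edot (v - xstar) (v - xstar)
     + edot (noise_direction t x v) (g - G)
     + noise_weight t * (edot (g - G) (g - G) - sigma ^+ 2 * edot G G).
Proof.
move=> t0 xp; cbv zeta; set G := gradient f x.
have [df cf lip] := fS.
have s0 : 0 < s by exact: noise_factor_gt0.
have := descent_lemma L f x (x - (s * L)^-1 *: g) df (fun z w => lip z w).
have := gradient_lower_bound f x xstar (df _) cf.
have := gradient_lower_bound f x p (df _) cf.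
rewrite -[p - x]opprB xp [x - _ *: g]addrC addrK (addrC _ x).
set fp := f p; set fx := f x; set fs := f xstar; set fn := f (x - _).
have -> : v - (s ^+ 2 * L * t)^-1 *: g - xstar =
          v - xstar - (s ^+ 2 * L * t)^-1 *: g by rewrite addrAC.
rewrite /noise_direction -/G.
have -> : v - x = v - xstar + (xstar - x) by rewrite subrKA.
move: (v - xstar) => w.
rewrite !edotE !(edotC g G) !(edotC g w) !(edotC w G).
set GG := edot G G; set Gg := edot G g; set gg := edot g g.
set gw := edot w g; set Gw := edot G w; set ww := edot w w.
set Gx := edot G xstar; set Gy := edot G x.
have sE : sigma ^+ 2 = s - 1 by rewrite /s; ring.
rewrite sE /noise_weight; set c := (s * L)^-1.
rewrite -subr_ge0 => at_p; rewrite -subr_ge0 => /(mulr_ge0 (ltW t0)) at_xstar.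
have t1 : 0 <= 1 + t by lra.
rewrite -subr_ge0 => /(mulr_ge0 t1) descent.
have GG0 : 0 <= t / (2 * (s * L)) * GG.
  by rewrite mulr_ge0 ?edot_ge0// divr_ge0 ?ltW// !mulr_gt0.
rewrite -subr_ge0.
(* What remains is the identity between the difference of the sides and the sum
   of the four nonnegative terms. *)
apply: le_trans (addr_ge0 (addr_ge0 (addr_ge0 at_p at_xstar) descent) GG0) _.
rewrite le_eqVlt; apply/orP; left; apply/eqP; rewrite /c.
by field; rewrite !gt_eqF.
Qed.

End OneStep.

(** * Square-integrable random vectors *)

Section RandomVectors.
Context {disp : measure_display} {T : measurableType disp} {R : realType}
  {d : nat}.
Implicit Types X Y : T -> 'rV[R]_d.

Lemma random_vectorD X Y : random_vector X -> random_vector Y ->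
  random_vector (fun w => X w + Y w).
Proof.
move=> mX mY i; under eq_fun do rewrite mxE.
exact: measurable_funD.
Qed.

Lemma random_vectorZ (a : R) X : random_vector X ->
  random_vector (fun w => a *: X w).
Proof.
move=> mX i; under eq_fun do rewrite mxE.
exact: measurable_funM.
Qed.

Lemma random_vector_cst (c : 'rV[R]_d) : random_vector (fun _ : T => c).
Proof. by move=> i; exact: measurable_cst. Qed.

Lemma random_vectorB X Y : random_vector X -> random_vector Y ->
  random_vector (fun w => X w - Y w).
Proof.
move=> mX mY; under [X in random_vector X]eq_fun do rewrite -scaleN1r.
by apply: random_vectorD => //; exact: random_vectorZ.
Qed.

Lemma measurable_edot X Y : random_vector X -> random_vector Y ->
  measurable_fun setT (fun w => edot (X w) (Y w)).
Proof.
by move=> mX mY; apply: measurable_sum => i; exact: measurable_funM.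
Qed.

Variable P : probability T R.

Definition square_integrable X : Prop :=
  forall i, (fun w => X w ord0 i) \in Lfun P 2%:E.

Lemma square_integrable_random_vector X :
  square_integrable X -> random_vector X.
Proof. by move=> X2 i; have := X2 i; rewrite inE => /andP[/[!inE]]. Qed.

Lemma square_integrableD X Y : square_integrable X -> square_integrable Y ->
  square_integrable (fun w => X w + Y w).
Proof.
move=> X2 Y2 i; under eq_fun do rewrite mxE.
apply: (Lfun_addr_closed P _).2 => //.
exact: lee1n.
Qed.

Lemma square_integrableZ (a : R) X : square_integrable X ->
  square_integrable (fun w => a *: X w).
Proof.
move=> X2 i; under eq_fun do rewrite mxE mulrC.
by apply: Lfun_scale => //; rewrite ler1n.
Qed.

Lemma square_integrable_cst (c : 'rV[R]_d) :
  square_integrable (fun _ => c).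
Proof. by move=> i; exact: Lfun_cst. Qed.

Lemma square_integrableB X Y : square_integrable X -> square_integrable Y ->
  square_integrable (fun w => X w - Y w).
Proof.
move=> X2 Y2; under [X in square_integrable X]eq_fun do rewrite -scaleN1r.
by apply: square_integrableD => //; exact: square_integrableZ.
Qed.

Lemma square_integrableP X : random_vector X ->
  (\int[P]_w (enorm (X w) ^+ 2)%:E < +oo)%E -> square_integrable X.
Proof.
move=> mX Xoo i; have mXi := mX i.
rewrite inE; apply/andP; split; first by rewrite inE.
rewrite inE /= /finite_norm unlock poweR_lty//.
apply: le_lt_trans Xoo; apply: ge0_le_integral => //.
- by move=> w _; rewrite lee_fin powR_ge0.
- apply/measurable_EFinP.
  by apply: (measurableT_comp (measurable_powR _)); exact: measurableT_comp.
- apply/measurable_EFinP; under eq_fun do rewrite enorm_sqr.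
  exact: measurable_edot.
- move=> w _ /=; rewrite lee_fin powR_mulrn// real_normK ?num_real//.
  exact: coord_sqr_le.
Qed.

Lemma Lfun1_edot X Y : square_integrable X -> square_integrable Y ->
  (fun w => edot (X w) (Y w)) \in Lfun P 1.
Proof.
move=> X2 Y2; rewrite (_ : (fun w => _) =
    \sum_(i < d) (fun w => X w ord0 i * Y w ord0 i)).
  by apply: rpred_sum => i _; exact: Lfun2_mul_Lfun1.
by apply/funext => w; rewrite fct_sumE.
Qed.

End RandomVectors.

(** * Consequences of the conditional moment conditions *)

Section ConditionalExpectation.
Context {disp : measure_display} {T : measurableType disp} {R : realType}
  {d : nat}.
Variables (P : probability T R) (G : set_system T).
Hypothesis GT : G `<=` measurable.

Definition adapted (U : T -> 'rV[R]_d) : Prop :=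
  @random_vector _ (g_sigma_algebraType G) R d U.

(** Y is the conditional expectation of X, so the coordinates of X - Y have zero
    mean on all events generated by G; hence X - Y is orthogonal to U. *)
Lemma expectation_edot_residual (U X Y : T -> 'rV[R]_d) :
  (forall i, cond_expectation P <<s G >> (fun w => (X w ord0 i)%:E)
     (fun w => (Y w ord0 i)%:E)) ->
  square_integrable P X -> square_integrable P Y -> square_integrable P U ->
  adapted U ->
  ('E_P[fun w => edot (U w) (X w - Y w)] = 0)%E.
Proof.
move=> XY X2 Y2 U2 mU.
have L21 := Lfun_subset12 (fin_num_measure P _ measurableT).
rewrite (_ : (fun w => _) =
    \sum_(i < d) (fun w => U w ord0 i * (X w - Y w) ord0 i)); last first.
  by apply/funext => w; rewrite fct_sumE.
rewrite -(big_map _ xpredT id) expectation_sum; last first.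
  move=> _ /mapP[i _ ->]; apply: Lfun2_mul_Lfun1; first exact: U2.
  by have := square_integrableB P _ _ X2 Y2 i.
rewrite big_map big1// => i _; rewrite unlock.
have iX := (Lfun1_integrable _ _).1 (L21 _ (X2 i)).
have iY := (Lfun1_integrable _ _).1 (L21 _ (Y2 i)).
have XY2 := square_integrableB P _ _ X2 Y2 i.
apply: (integral_mul_sub_measurable P G (fun w => (X w - Y w) ord0 i)) => //.
- exact/Lfun1_integrable/L21.
- move=> A GA; have mA := generated_measurable _ _ GT GA.
  have [_ _ /(_ A GA)] := XY i.
  under [in X in _ -> X]eq_integral do rewrite !mxE EFinB.
  move=> E; rewrite integralB//= ?E ?subee//.
  + apply: integrable_fin_num => //; exact: integrableS iY.
  + exact: integrableS iX.
  + exact: integrableS iY.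
- exact: mU.
- exact/Lfun1_integrable/(Lfun2_mul_Lfun1 (U2 i) XY2).
Qed.

(** A version Y of a conditional expectation may be negative on a null set, so
    the comparison goes through its positive part. *)
Lemma integral_le_cond_bound (X Y B : T -> \bar R) :
  cond_expectation P <<s G >> X Y ->
  measurable_fun setT B -> (forall w, 0 <= B w)%E ->
  {ae P, forall w, (Y w <= B w)%E} ->
  (\int[P]_w X w <= \int[P]_w B w)%E.
Proof.
move=> [_ mY EY] mB B0 YB.
have mY' : measurable_fun setT Y.
  move=> _ C mC; rewrite setTI.
  exact: (generated_measurable _ _ GT (mY _ mC)).
rewrite (EY setT); last exact: (@measurableT _ (g_sigma_algebraType G)).
rewrite integralE; apply: (@le_trans _ _ (\int[P]_w Y^\+ w)%E).
  apply: geeDl; rewrite oppe_le0.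
  by apply: integral_ge0 => w _; exact: funeneg_ge0.
apply: ae_ge0_le_integral => //; first exact: measurable_funepos.
by apply: filterS YB => w Yw _; rewrite funeposE ge_max Yw B0.
Qed.

End ConditionalExpectation.

Section Adapted.
Context {disp : measure_display} {T : measurableType disp} {R : realType}
  {d : nat}.

(** Naming the generators of [history x0 g k] lets the history be the measurable
    structure of a type, over which random vectors are the adapted ones. *)
Definition history_generators (x0 : T -> 'rV[R]_d) (g : nat -> T -> 'rV[R]_d)
    (k : nat) : set_system T :=
  coordinate_preimages x0 `|`
  \bigcup_(j in [set j | (j < k)%N]) coordinate_preimages (g j).

Lemma adaptedS (G H : set_system T) (U : T -> 'rV[R]_d) :
  G `<=` H -> adapted G U -> adapted H U.
Proof.
move=> GH mU i _ B mB; have := mU i measurableT B mB.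
exact: sub_smallest2r.
Qed.

Lemma adapted_coordinate_preimages (G : set_system T) (U : T -> 'rV[R]_d) :
  coordinate_preimages U `<=` G -> adapted G U.
Proof.
move=> UG i _ B mB; apply: sub_gen_smallest; apply: UG.
by exists i => //; exists B.
Qed.

Lemma coordinate_preimages_measurable (U : T -> 'rV[R]_d) :
  random_vector U -> coordinate_preimages U `<=` measurable.
Proof. by move=> mU _ [i _ [B mB <-]]; exact: mU. Qed.

End Adapted.

(** * Moments of a smooth function and of its gradient *)

Section SmoothMoments.
Context {R : realType} {d : nat} {disp : measure_display}
  {T : measurableType disp}.
Variables (P : probability T R) (L : R) (f : 'rV[R]_d -> R) (xstar : 'rV[R]_d).
Hypotheses (fS : smooth_convex L f) (fmin : forall y, f xstar <= f y).
Implicit Type X : T -> 'rV[R]_d.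

Lemma ge0_le_Lfun1 (h k : T -> R) : measurable_fun setT h ->
  (forall w, 0 <= h w <= k w) -> k \in Lfun P 1 -> h \in Lfun P 1.
Proof.
move=> mh hk /Lfun1_integrable ik; apply/Lfun1_integrable.
apply: le_integrable ik => //; first exact/measurable_EFinP.
move=> w _; have /andP[h0 hkw] := hk w.
by rewrite lee_fin !ger0_norm// (le_trans h0).
Qed.

Lemma Lfun1_measurable (h : T -> R) :
  h \in Lfun P 1 -> measurable_fun setT h.
Proof. by rewrite inE => /andP[/[!inE]]. Qed.

Lemma Lfun1_fin (h : T -> R) : (forall w, 0 <= h w) -> h \in Lfun P 1 ->
  (\int[P]_w (h w)%:E < +oo)%E.
Proof.
by move=> h0 /Lfun1_integrable ih; apply: integrable_lty.
Qed.

Lemma measurable_objective X : random_vector X ->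
  measurable_fun setT (fun w => f (X w)).
Proof.
move=> mX; apply: (measurable_continuous_comp f X) => // z.
by case: fS => df _ _; exact: differentiable_continuous.
Qed.

(** The gap f - f(xstar) is nonnegative and, by the descent lemma at the
    minimizer, at most quadratic. *)
Lemma Lfun1_objective X : square_integrable P X ->
  (fun w => f (X w) - f xstar) \in Lfun P 1.
Proof.
move=> X2; have [df _ lip] := fS.
have Y2 : square_integrable P (fun w => X w - xstar).
  by apply: square_integrableB => //; exact: square_integrable_cst.
apply: (ge0_le_Lfun1 _ (fun w => edot (gradient f xstar) (X w - xstar)
    + edot (X w - xstar) (X w - xstar) * (L / 2))).
- apply: measurable_funB => //; apply: measurable_objective.
  exact: square_integrable_random_vector X2.
- move=> w; rewrite subr_ge0 fmin/= lerBlDl addrA [_ * (L / 2)]mulrC.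
  exact: descent_lemma.
- apply: rpredD; last first.
    by apply: Lfun_scale => //; exact: Lfun1_edot.
  by apply: Lfun1_edot => //; exact: square_integrable_cst.
Qed.

(** Lipschitz continuity compares the gradient at X with its value at xstar. *)
Lemma square_integrable_gradient X : square_integrable P X ->
  random_vector (fun w => gradient f (X w)) ->
  square_integrable P (fun w => gradient f (X w)).
Proof.
move=> X2 mG; have [_ _ lip] := fS.
pose c := gradient f xstar.
have Y2 : square_integrable P (fun w => X w - xstar).
  by apply: square_integrableB => //; exact: square_integrable_cst.
have D2 : square_integrable P (fun w => gradient f (X w) - c).
  have mD := random_vectorB _ _ mG (random_vector_cst c).
  apply: square_integrableP => //; apply: Lfun1_fin => [w|].
    exact: sqr_ge0.
  apply: (ge0_le_Lfun1 _ (fun w => edot (X w - xstar) (X w - xstar) * L ^+ 2)).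
  + by under eq_fun do rewrite enorm_sqr; exact: measurable_edot.
  + move=> w; rewrite sqr_ge0/= -enorm_sqr mulrC -exprMn.
    have h := lip xstar (X w).
    by rewrite ler_sqr ?nnegrE ?(le_trans _ h) ?enorm_ge0.
  + by apply: Lfun_scale => //; exact: Lfun1_edot.
under [X in square_integrable _ X]eq_fun => w
  do rewrite -(subrK c (gradient f _)).
by apply: square_integrableD => //; exact: square_integrable_cst.
Qed.

End SmoothMoments.

(** * Convergence of the SHANG++ iterates *)

Section SHANGppConvergence.
Context {R : realType} {d : nat} {disp : measure_display}
  {T : measurableType disp}.
Variables (P : probability T R) (L sigma m : R) (f : 'rV[R]_d -> R)
  (xstar : 'rV[R]_d) (g x v : nat -> T -> 'rV[R]_d).
Hypotheses (L0 : 0 < L) (m0 : 0 <= m) (fS : smooth_convex L f).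
Hypothesis fmin : forall y, f xstar <= f y.
Hypotheses (mx0 : random_vector (x 0%N)) (v0 : forall w, v 0%N w = x 0%N w).
Hypothesis mg : forall k, random_vector (g k).
Hypothesis rec : shangpp L sigma m g x v.
Hypothesis unbiased : cond_unbiased P f x g.
Hypothesis mns : mult_noise_scaling P sigma f x g.

Let s := 1 + sigma ^+ 2.
Let t := talpha m.
Let F := history_generators (x 0%N) g.
Let xp := xplus L sigma m g x.
Let grad k w := gradient f (x k w).
Let energy k w :=
  f (xp k w) - f xstar + tgamma L sigma m k / 2 * enorm (v k w - xstar) ^+ 2.

Let t0 k : 0 < t k. Proof. exact: talpha_gt0. Qed.

Lemma xplusE k w : xp k w = x k w - (s * L)^-1 *: g k w.
Proof. by rewrite /xp /xplus talpha_beta. Qed.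

Lemma x_step k w : x k.+1 w - xp k w = t k *: (v k w - x k.+1 w).
Proof.
have [+ _] := rec k w => /(congr1 (fun z => t k *: z)).
rewrite scalerA divff ?gt_eqF// scale1r scalerBr scalerA => xE.
by rewrite /xp /xplus opprB addrA addrAC xE subrK.
Qed.

Lemma xS k w : x k.+1 w = (1 + t k)^-1 *: (xp k w + t k *: v k w).
Proof.
have tn : 1 + t k != 0 by rewrite gt_eqF// ltr_pwDl// ltW.
apply: (canRL (scalerK tn)).
have := x_step k w; rewrite scalerBr => /eqP; rewrite subr_eq => /eqP E.
by rewrite scalerDl scale1r {1}E addrAC subrK addrC.
Qed.

Lemma vS k w : v k.+1 w = v k w - (s ^+ 2 * L * t k)^-1 *: g k.+1 w.
Proof.
have [_ /(congr1 (fun z => alpha k *: z))] := rec k w.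
rewrite scalerA divff ?scale1r ?gt_eqF ?alpha_gt0// scalerN scalerA.
rewrite alpha_div_gamma// => /eqP.
by rewrite subr_eq addrC => /eqP.
Qed.

Lemma F_measurable k : F k `<=` measurable.
Proof.
by move=> A [|[j _]]; exact: coordinate_preimages_measurable.
Qed.

Lemma FS k : F k `<=` F k.+1.
Proof.
move=> A [A0|[j jk Aj]]; [by left|right; exists j => //].
exact: ltnW.
Qed.

Lemma adapted_g k : adapted (F k.+1) (g k).
Proof.
by apply: adapted_coordinate_preimages => A Ag; right; exists k => /=.
Qed.

(** The sample g k enters v k but not x k, so v k is known one step later than
    x k, and just before g k.+1 is drawn. *)
Lemma adapted_iterates k : adapted (F k) (x k) /\ adapted (F k.+1) (v k).
Proof.
elim: k => [|k [xk vk]].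
  have ax : adapted (F 0) (x 0%N).
    by apply: adapted_coordinate_preimages => A ?; left.
  split => //; rewrite (funext v0); exact: adaptedS (@FS 0) ax.
split.
  rewrite (funext (xS k)).
  apply: random_vectorZ; apply: random_vectorD; last exact: random_vectorZ.
  rewrite (funext (xplusE k)).
  apply: random_vectorB; first exact: adaptedS (@FS k) xk.
  by apply: random_vectorZ; exact: adapted_g.
rewrite (funext (vS k)).
apply: random_vectorB; first exact: adaptedS (@FS k.+1) vk.
by apply: random_vectorZ; exact: adapted_g.
Qed.

(** Adaptedness of the gradient is part of unbiasedness, the gradient being a
    version of a conditional expectation given the history. *)
Lemma adapted_grad k : adapted (F k) (grad k).
Proof.
move=> i; apply/measurable_EFinP => _ B mB; rewrite setTI.
by have [_ + _] := unbiased k i; apply.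
Qed.

Lemma random_vector_adapted k (U : T -> 'rV[R]_d) :
  adapted (F k) U -> random_vector U.
Proof.
by move=> aU i; apply: (sub_measurableW (F k) _ (@F_measurable k)); exact: aU.
Qed.

Lemma random_vector_grad k : random_vector (grad k).
Proof. exact: random_vector_adapted (adapted_grad k). Qed.

(** The conditional bound on the event of full probability. *)
Lemma expectation_noise_le k :
  ('E_P[(fun w => enorm (g k w - grad k w) ^+ 2)%R] <=
   'E_P[(fun w => sigma ^+ 2 * enorm (grad k w) ^+ 2)%R])%E.
Proof.
rewrite unlock.
have [Y XY YB] := mns k.
apply: (integral_le_cond_bound P (F k) (F_measurable k) _ _ _ XY _ _ YB).
  apply/measurable_EFinP/measurable_funM => //.
  under eq_fun do rewrite enorm_sqr.
  by apply: measurable_edot; exact: random_vector_grad.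
by move=> w; rewrite lee_fin mulr_ge0 ?sqr_ge0.
Qed.

(** The second moment of the noise is controlled by that of the gradient. *)
Lemma square_integrable_g k : square_integrable P (x k) ->
  square_integrable P (grad k) /\ square_integrable P (g k).
Proof.
move=> x2.
have G2 : square_integrable P (grad k).
  exact: (square_integrable_gradient P L f xstar fS _ x2
    (random_vector_grad k)).
split=> //.
have N2 : square_integrable P (fun w => g k w - grad k w).
  apply: square_integrableP.
    by apply: random_vectorB => //; exact: random_vector_grad.
  have := expectation_noise_le k; rewrite unlock => /le_lt_trans; apply.
  apply: Lfun1_fin => [w|]; first by rewrite mulr_ge0 ?sqr_ge0.
  under eq_fun do rewrite enorm_sqr mulrC.
  by apply: Lfun_scale => //; exact: Lfun1_edot.
rewrite (_ : g k = fun w => g k w - grad k w + grad k w).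
  exact: square_integrableD.
by apply/funext => w; rewrite subrK.
Qed.

Lemma energy_ge0 k w : 0 <= energy k w.
Proof.
rewrite addr_ge0 ?subr_ge0// mulr_ge0 ?sqr_ge0// divr_ge0//.
exact/ltW/tgamma_gt0.
Qed.

Lemma random_vector_xp k : random_vector (xp k).
Proof.
rewrite (funext (xplusE k)); apply: random_vectorB.
  exact: random_vector_adapted (adapted_iterates k).1.
exact: random_vectorZ.
Qed.

Lemma random_vector_v k : random_vector (v k).
Proof. exact: random_vector_adapted (adapted_iterates k).2. Qed.

Lemma measurable_energy k : measurable_fun setT (energy k).
Proof.
apply: measurable_funD.
  apply: measurable_funB => //; apply: (measurable_objective L) => //.
  exact: random_vector_xp.
apply: measurable_funM => //; under eq_fun do rewrite enorm_sqr.
have mv := random_vectorB _ _ (random_vector_v k) (random_vector_cst xstar).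
exact: measurable_edot.
Qed.

Lemma square_integrable_iterates k : square_integrable P (x 0%N) ->
  square_integrable P (x k) /\ square_integrable P (v k).
Proof.
move=> x02; elim: k => [|k [x2 v2]]; first by split => //; rewrite (funext v0).
have [_ g2] := square_integrable_g k x2.
have xS2 : square_integrable P (x k.+1).
  rewrite (funext (xS k)); apply: square_integrableZ; apply: square_integrableD.
    rewrite (funext (xplusE k)); apply: square_integrableB => //.
    exact: square_integrableZ.
  exact: square_integrableZ.
split => //; rewrite (funext (vS k)); apply: square_integrableB => //.
by apply: square_integrableZ; exact: (square_integrable_g k.+1 xS2).2.
Qed.

Lemma Lfun1_energy k : square_integrable P (x 0%N) -> energy k \in Lfun P 1.
Proof.
move=> /(square_integrable_iterates k)[x2 v2].
have [_ g2] := square_integrable_g k x2.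
apply: rpredD.
  apply: (Lfun1_objective P L) => //; rewrite (funext (xplusE k)).
  by apply: square_integrableB => //; exact: square_integrableZ.
under eq_fun do rewrite enorm_sqr mulrC; apply: Lfun_scale => //.
have w2 : square_integrable P (fun w => v k w - xstar).
  by apply: square_integrableB => //; exact: square_integrable_cst.
exact: Lfun1_edot.
Qed.

Let direction k w :=
  noise_direction L sigma f xstar (t k) (x k.+1 w) (v k w).
Let noise k w := g k.+1 w - grad k.+1 w.
Let bt k := noise_weight L sigma (t k).

Lemma energy_step_pointwise k w :
  (1 + t k) * energy k.+1 w <=
  energy k w + (edot (direction k w) (noise k w) +
  bt k * (enorm (noise k w) ^+ 2 - sigma ^+ 2 * enorm (grad k.+1 w) ^+ 2)).
Proof.
have := one_step L sigma f xstar L0 fS (t k)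
  (xp k w) (x k.+1 w) (v k w) (g k.+1 w) (t0 k) (x_step k w).
rewrite -xplusE -vS -(tgammaE m0 k) /=.
rewrite /energy addrA !enorm_sqr; apply: le_trans.
rewrite mulrDr lerD2l mulrA.
apply: ler_wpM2r; first exact: edot_ge0.
rewrite mulrA ler_pM2r ?invr_gt0//.
exact: tgamma_decay.
Qed.

Lemma expectation_energy_step k : square_integrable P (x 0%N) ->
  ((1 + t k)%:E * 'E_P[energy k.+1] <= 'E_P[energy k])%E.
Proof.
move=> x02.
have [_ v2] := square_integrable_iterates k x02.
have [x2 _] := square_integrable_iterates k.+1 x02.
have [G2 g2] := square_integrable_g k.+1 x2.
have N2 : square_integrable P (noise k) by exact: square_integrableB.
have U2 : square_integrable P (direction k).
  apply: square_integrableB; first exact: square_integrableZ.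
  apply: square_integrableZ; apply: square_integrableB => //.
  exact: square_integrable_cst.
have aU : adapted (F k.+1) (direction k).
  apply: random_vectorB.
    by apply: random_vectorZ; exact: adapted_grad.
  apply: random_vectorZ; apply: random_vectorB; last exact: random_vector_cst.
  exact: (adapted_iterates k).2.
have UN0 := expectation_edot_residual P _ (F_measurable k.+1) _ _ _
  (unbiased k.+1) g2 G2 U2 aU.
have iUN : (fun w => edot (direction k w) (noise k w)) \in Lfun P 1.
  exact: Lfun1_edot.
have iN : (fun w => enorm (noise k w) ^+ 2) \in Lfun P 1.
  by under eq_fun do rewrite enorm_sqr; exact: Lfun1_edot.
have iG : (fun w => sigma ^+ 2 * enorm (grad k.+1 w) ^+ 2) \in Lfun P 1.
  under eq_fun do rewrite enorm_sqr mulrC.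
  by apply: Lfun_scale => //; exact: Lfun1_edot.
have iNG : (fun w => enorm (noise k w) ^+ 2) \-
    (fun w => sigma ^+ 2 * enorm (grad k.+1 w) ^+ 2) \in Lfun P 1.
  exact: rpredB.
have ie := Lfun1_energy k x02.
have iS := Lfun1_energy k.+1 x02.
have b0 : 0 <= bt k.
  apply: divr_ge0; first by rewrite ltW// addr_gt0.
  apply: mulr_ge0 => //; apply: mulr_ge0; last exact: ltW.
  exact: sqr_ge0.
have : ('E_P[(1 + t k)%R \o* energy k.+1] <= 'E_P[energy k \+
  ((fun w => edot (direction k w) (noise k w)) \+
   bt k \o* ((fun w => enorm (noise k w) ^+ 2) \-
    (fun w => sigma ^+ 2 * enorm (grad k.+1 w) ^+ 2)))%R])%E.
  apply: expectation_le; [| |move=> w|move=> w|apply: aeW => w].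
  - by apply: (Lfun1_measurable P); exact: Lfun_scale.
  - apply: (Lfun1_measurable P); apply: rpredD => //; apply: rpredD => //.
    exact: Lfun_scale.
  - by rewrite mulr_ge0 ?energy_ge0// ltW// addr_gt0.
  - rewrite /= [_ * bt k]mulrC; apply: le_trans _ (energy_step_pointwise k w).
    by rewrite mulr_ge0 ?energy_ge0// ltW// addr_gt0.
  - rewrite /= [_ * bt k]mulrC [leLHS]mulrC; exact: energy_step_pointwise.
rewrite expectationZl// => /le_trans; apply.
rewrite expectationD//; last by apply: rpredD => //; exact: Lfun_scale.
rewrite expectationD//; last exact: Lfun_scale.
rewrite expectationZl// UN0 add0e expectationB//.
rewrite geeDl// mule_ge0_le0 ?lee_fin//.
rewrite sube_le0.
exact: expectation_noise_le.
Qed.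

Lemma expectation_energy_rate_square_integrable k :
  square_integrable P (x 0%N) ->
  ('E_P[energy k] <= (rate (m := m) k)%:E * 'E_P[energy 0%N])%E.
Proof.
move=> x02; elim: k => [|k IH]; first by rewrite rate0// mul1e.
have t1 : 0 < 1 + t k by rewrite addr_gt0.
rewrite -(lee_pmul2l (x := (1 + t k)%:E)) ?lte_fin//.
rewrite muleA -EFinM -rateS//.
exact: le_trans (expectation_energy_step k x02) IH.
Qed.

(** The initial energy dominates its distance term, whose weight is positive. *)
Lemma square_integrable_x0 :
  ('E_P[energy 0%N] < +oo)%E -> square_integrable P (x 0%N).
Proof.
rewrite unlock => Eoo.
have c0 := tgamma_gt0 L0 m0 0 (sigma := sigma).
have w2 : square_integrable P (fun w => v 0%N w - xstar).
  apply: square_integrableP.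
    by apply: random_vectorB; [exact: random_vector_v|exact: random_vector_cst].
  apply: Lfun1_fin => [w|]; first exact: sqr_ge0.
  apply: (ge0_le_Lfun1 _ _ (2 / tgamma L sigma m 0 \o* energy 0%N)).
  - under eq_fun do rewrite enorm_sqr.
    have mv := random_vectorB _ _ (random_vector_v 0) (random_vector_cst xstar).
    exact: measurable_edot.
  - move=> w; rewrite sqr_ge0/= /energy.
    set N := enorm _ ^+ 2; set D := f _ - _.
    have D0 : 0 <= D by rewrite subr_ge0.
    have NE : N = tgamma L sigma m 0 / 2 * N * (2 / tgamma L sigma m 0).
      by field; rewrite gt_eqF.
    rewrite [leLHS]NE.
    by apply: ler_wpM2r; [rewrite divr_ge0// ltW|rewrite lerDr].
  - apply: Lfun_scale => //; apply/Lfun1_integrable/integrableP; split.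
      exact/measurable_EFinP/measurable_energy.
    by under eq_integral do rewrite gee0_abs ?lee_fin ?energy_ge0//.
rewrite -(funext v0) (_ : v 0%N = fun w => v 0%N w - xstar + xstar).
  by apply: square_integrableD => //; exact: square_integrable_cst.
by apply/funext => w; rewrite subrK.
Qed.

Lemma expectation_energy_rate k :
  ('E_P[energy k] <= (rate (m := m) k)%:E * 'E_P[energy 0%N])%E.
Proof.
have [Eoo|] := ltP ('E_P[energy 0%N])%E +oo%E.
  exact/expectation_energy_rate_square_integrable/square_integrable_x0.
rewrite leye_eq => /eqP ->; rewrite gt0_muley ?leey// lte_fin divr_gt0//.
  by rewrite mulr_gt0// ltr_pwDl// mulr_ge0.
by rewrite mulr_gt0 ?shifted_index_gt0.
Qed.

End SHANGppConvergence.

Theorem theorem2p3 (R : realType) (d : nat) (disp : measure_display)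
    (T : measurableType disp) (P : probability T R)
    (L sigma m : R) (f : 'rV[R]_d -> R) (xstar : 'rV[R]_d)
    (g x v : nat -> T -> 'rV[R]_d) :
  measure_is_complete P ->
  0 < L -> 0 <= sigma -> 0 <= m ->
  smooth_convex L f ->
  (forall y, f xstar <= f y) ->
  random_vector (x 0%N) -> (forall w, v 0%N w = x 0%N w) ->
  (forall k, random_vector (g k)) ->
  shangpp L sigma m g x v ->
  cond_unbiased P f x g ->
  mult_noise_scaling P sigma f x g ->
  let energy (k : nat) (w : T) : R :=
    f (xplus L sigma m g x k w) - f xstar
    + tgamma L sigma m k / 2 * enorm (v k w - xstar) ^+ 2 in
  forall k : nat,
    ('E_P[energy k.+1] <=
      (((1 + 2 * m) * (2 + 2 * m)) /
       ((k%:R + 2 + 2 * m) * (k%:R + 3 + 2 * m)))%:E * 'E_P[energy 0%N])%E.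
Proof.
move=> _ L0 _ m0 fS fmin mx0 v0 mg rec unbiased mns /= k.
have := expectation_energy_rate P L sigma m f xstar g x v L0 m0 fS fmin mx0 v0
  mg rec unbiased mns k.+1.
rewrite /rate -(natr1 k).
have -> : k%:R + 1 + 1 + 2 * m = k%:R + 2 + 2 * m by ring.
by have -> : k%:R + 1 + 2 + 2 * m = k%:R + 3 + 2 * m by ring.
Qed.
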